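(* Let $g=\sum_{i=1}^m a_i 1_{C_i}$ be a simple function, where $a_1,\dots,a_m$ are distinct reals and $C_1,\dots,C_m$ form a measurable partition of $X$. Assume the map $\theta$ is invertible, and put $\psi_t(y) := \int_X g\circ\varphi_t \, dP_{\theta^{-1}(y)}$ for $t\in T$, $y\in(y_{\min},y_{\max})$, where $T=-T$. Suppose that each $\varphi_t$ is invertible with $\varphi_t^{-1}=\varphi_{-t}$ and preserves $\mu$ (i.e. $\mu\circ\varphi_t^{-1}=\mu$), and that strong detailed balance holds: $$\mu[\varphi_t^{-1}(C_i)\cap C_j]=\mu[C_i\cap\varphi_t^{-1}(C_j)]\quad\text{for all } i,j \text{ and all } t\in T.$$ Then $\psi_t(y)=\psi_{-t}(y)$ for all $t\in T$ and all $y\in(y_{\min},y_{\max})$.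
   Context: Setting. $(X,d)$ is a complete separable metric space with its Borel $\sigma$-algebra and $\mu$ is a Borel probability measure on $X$. $g: X\to\mathbb{R}$ is measurable, bounded, and continuous $\mu$-almost everywhere (i.e. its set of discontinuity points is $\mu$-null). $y_{\min}=\inf g(X)$, $y_{\max}=\sup g(X)$, $Y=[y_{\min},y_{\max}]$. $T\subseteq\mathbb{R}$ is a set of times with $0\in T$; for each $t\in T$, $\varphi_t:X\to X$ is measurable and continuous $\mu$-a.e., with $\varphi_0=\mathrm{id}$. Canonical measures. For $\lambda\in\mathbb{R}$, $Z(\lambda)=\int_X e^{\lambda g}\,d\mu$ and $P_\lambda$ is the probability measure with $dP_\lambda = \frac{e^{\lambda g}}{Z(\lambda)}\,d\mu$. The map $\theta:[-\infty,+\infty]\to Y$ is given by $\theta(\lambda)=\int_X g\,dP_\lambda$ for $\lambda\in\mathbb{R}$, $\theta(-\infty)=y_{\min}$, $\theta(+\infty)=y_{\max}$. *)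

(* Defs.v *)
From HB Require Import structures.
From mathcomp Require Import all_boot all_order all_algebra.
From mathcomp Require Import all_classical all_reals all_analysis measurable_realfun.

Set Implicit Arguments.
Unset Strict Implicit.
Unset Printing Implicit Defensive.

Import Order.TTheory GRing.Theory Num.Theory.
Import numFieldNormedType.Exports.

Local Open Scope classical_set_scope.
Local Open Scope ring_scope.

(* A complete metric space carrying a sigma-algebra. The structure itself does
   not relate the sigma-algebra to the topology: see [borel_sigma_algebra]. *)
#[short(type="measurableCompleteMetricType")]
HB.structure Definition MeasurableCompleteMetric (d : measure_display)
    (R : realType) :=
  {X of Metric R X & Complete X & Measurable d X}.

Definition separable (X : topologicalType) :=
  exists2 D : set X, countable D & dense D.

Definition borel_sigma_algebra (d : measure_display) (R : realType)
    (X : measurableCompleteMetricType d R) :=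
  @measurable d X = <<s @open X >>.

(* The set of discontinuity points is mu-null. *)
Definition continuous_ae (d : measure_display) (R : realType)
    (X : measurableCompleteMetricType d R) (mu : {measure set X -> \bar R})
    (V : topologicalType) (f : X -> V) :=
  mu.-negligible [set x | ~ {for x, continuous f}].

Section canonical_measure.
Context (d : measure_display) (X : measurableType d) (R : realType).
Variables (mu : probability X R) (g : {mfun X >-> R}).

Definition partition_function (lambda : R) : R :=
  \int[mu]_x expR (lambda * g x).

(* The measure with density e^(lambda g) / Z(lambda) with respect to mu. Its
   total mass is 1 when g is bounded: see [canonical_measure_setT]. *)
Definition canonical_measure (lambda : R) (A : set X) : \bar R :=
  (\int[mu]_(x in A) (expR (lambda * g x) / partition_function lambda)%:E)%E.

Section canonical_measure_is_measure.
Variable lambda : R.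

Lemma partition_function_ge0 : 0 <= partition_function lambda.
Proof.
by apply: fine_ge0; apply: integral_ge0 => x _; rewrite lee_fin expR_ge0.
Qed.

Let density_ge0 x : 0 <= expR (lambda * g x) / partition_function lambda.
Proof. by rewrite divr_ge0 ?expR_ge0 ?partition_function_ge0. Qed.

Let measurable_expRg : measurable_fun setT (fun x => expR (lambda * g x)).
Proof. by apply: measurableT_comp => //; exact: measurable_funM. Qed.

Let canonical_measure0 : canonical_measure lambda set0 = 0%E.
Proof. by rewrite /canonical_measure integral_set0. Qed.

Let canonical_measure_ge0 A : (0 <= canonical_measure lambda A)%E.
Proof. by apply: integral_ge0 => x _; rewrite lee_fin. Qed.

Let canonical_measure_sigma_additive :
  semi_sigma_additive (canonical_measure lambda).
Proof.
move=> /= F mF tF mUF; rewrite /canonical_measure; apply: cvg_toP.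
  apply: ereal_nondecreasing_is_cvgn => m n mn.
  apply: lee_sum_nneg_natr => // k _ _.
  by apply: integral_ge0 => /= x _; rewrite lee_fin.
rewrite ge0_integral_bigcup//=.
- apply: measurable_funTS; apply: measurableT_comp => //.
  exact: measurable_funM.
- by move=> x _; rewrite lee_fin.
Qed.

HB.instance Definition _ := isMeasure.Build _ _ _ (canonical_measure lambda)
  canonical_measure0 canonical_measure_ge0 canonical_measure_sigma_additive.

Lemma canonical_measure_setT : bounded_fun g ->
  canonical_measure lambda setT = 1%E.
Proof.
move=> [M [_ gM]].
have gM1 x : `|g x| <= M + 1 by apply: gM => //; rewrite ltrDl.
have le_lM x : `|lambda * g x| <= `|lambda| * (M + 1).
  by rewrite normrM ler_wpM2l.
have Iexp : mu.-integrable setT (EFin \o (fun x => expR (lambda * g x))).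
  apply: measurable_bounded_integrable => //.
    by rewrite (le_lt_trans (probability_le1 _ _))// ltry.
  exists (expR (`|lambda| * (M + 1))); split; first exact: num_real.
  move=> y ltMy x _ /=; rewrite ger0_norm ?expR_ge0//.
  by rewrite (le_trans _ (ltW ltMy))// ler_expR (le_trans (ler_norm _)).
have fin_Z : (\int[mu]_x (expR (lambda * g x))%:E)%E \is a fin_num.
  exact: integrable_fin_num.
have Z_gt0 : 0 < partition_function lambda.
  apply: (@lt_le_trans _ _ (expR (- (`|lambda| * (M + 1))))).
    exact: expR_gt0.
  rewrite -lee_fin /partition_function /Rintegral fineK//.
  have -> : (expR (- (`|lambda| * (M + 1))))%:E =
      (\int[mu]_x (expR (- (`|lambda| * (M + 1))))%:E)%E.
    by rewrite integral_cst//= probability_setT mule1.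
  apply: ge0_le_integral => //.
  - exact: measurableT_comp.
  - move=> x _; rewrite lee_fin ler_expR lerNl.
    by rewrite (le_trans (ler_norm _))// normrN.
rewrite /canonical_measure.
under eq_integral do rewrite mulrC EFinM.
rewrite integralZl//= -(fineK fin_Z) -EFinM.
by rewrite mulVf// gt_eqF.
Qed.

End canonical_measure_is_measure.

Definition y_min : R := inf (range g).
Definition y_max : R := sup (range g).

Definition theta (lambda : \bar R) : R :=
  match lambda with
  | l%:E => \int[canonical_measure l]_x g x
  | -oo%E => y_min
  | +oo%E => y_max
  end.

(* theta : [-oo, +oo] -> Y = [y_min, y_max] is well defined and bijective. *)
Definition theta_invertible := set_bij [set: \bar R] `[y_min, y_max] theta.

(* When theta is invertible this is its inverse on Y. *)
Definition theta_inv (y : R) : \bar R := 'pinv_(fun=> 0%E) [set: \bar R] theta y.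

(* For y in ]y_min, y_max[, theta_inv y is neither -oo nor +oo, since theta
   sends these to y_min and y_max; [fine] only reads it as a real number. *)
Definition psi (phi : R -> X -> X) (t y : R) : R :=
  \int[canonical_measure (fine (theta_inv y))]_x g (phi t x).

End canonical_measure.

(* Main.v *)
Require Import Defs.
From HB Require Import structures.
From mathcomp Require Import all_boot all_order all_algebra.
From mathcomp Require Import all_classical all_reals all_analysis measurable_realfun.

Set Implicit Arguments.
Unset Strict Implicit.
Unset Printing Implicit Defensive.

Import Order.TTheory GRing.Theory Num.Theory.
Import numFieldNormedType.Exports.

Local Open Scope classical_set_scope.
Local Open Scope ring_scope.

(* Under P_lambda the expectation of g \o phi_t is the sum of the
   a_i * P_lambda (phi_t^-1 C_i). As g is constant on each cell C_j, P_lambda is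
   a multiple of mu there, so this expectation only depends on the numbers
   mu (phi_t^-1 C_i `&` C_j). By detailed balance such a number equals
   mu (C_i `&` phi_t^-1 C_j), and by invariance of mu, since
   phi_t^-1 (phi_(-t)^-1 C_i `&` C_j) = C_i `&` phi_t^-1 C_j, it is also the
   number attached to -t. *)

(** The [a i] may have either sign, so the sum leaves the integral by integrability: a bounded
    function is integrable against a finite measure. A single outer [fine] lets two such sums be
    compared term by term in [\bar R]. *)
Lemma Rintegral_simple (d : measure_display) (T : measurableType d)
    (R : realType) (mu : {measure set T -> \bar R}) (m : nat)
    (a : 'I_m -> R) (A : 'I_m -> set T) :
  (mu setT < +oo)%E -> (forall i, measurable (A i)) ->
  (\int[mu]_x (\sum_(i < m) a i * \1_(A i) x) =
   fine (\sum_(i < m) (a i)%:E * mu (A i))%E)%R.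
Proof.
move=> fin_mu mA; rewrite /Rintegral; congr fine.
have IA i : mu.-integrable setT (fun x => (\1_(A i) x)%:E).
  apply: measurable_bounded_integrable => //.
  exists 1; split=> [|y lt1y x _ /=]; first exact: num_real.
  by rewrite ger0_norm// (le_trans _ (ltW lt1y))// indicE lern1 leq_b1.
under eq_integral do rewrite -sumEFin.
rewrite integral_sum//; last by move=> i; exact: (integrableZl _ (a i) (IA i)).
apply: eq_bigr => i _; under eq_integral do rewrite EFinM.
by rewrite integralZl// integral_indic// setIT.
Qed.

Lemma measure_ord_partition (d : measure_display) (T : measurableType d)
    (R : realType) (mu : {measure set T -> \bar R}) (m : nat)
    (C : 'I_m -> set T) (A : set T) :
  partition [set: 'I_m] C [set: T] -> (forall i, measurable (C i)) ->
  measurable A -> mu A = (\sum_(i < m) mu (A `&` C i))%E.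
Proof.
move=> [coverC tC _] mC mA.
rewrite -[in LHS](setIT A) -coverC /cover setI_bigcupr.
rewrite measure_fin_bigcup//.
(* Finite additivity gives a sum over the finite set [[set: 'I_m]]; it is matched with the sum over
   the enumeration of ['I_m]. *)
- rewrite [RHS]fsbig_seq ?index_enum_uniq//; congr (\sum_(i \in _) _)%E.
  by apply/seteqP; split => i //= _; rewrite mem_index_enum.
- exact: finite_finset.
- by move=> i j _ _ [x [[_ Cix] [_ Cjx]]]; apply: tC => //; exists x.
- by move=> i _; exact: measurableI.
Qed.

(** The density of [P_lambda] depends on [x] only through [g x], so on [A] it is a constant that
    leaves the integral. *)
Lemma canonical_measure_level_set (d : measure_display)
    (X : measurableType d) (R : realType) (mu : probability X R)
    (g : {mfun X >-> R}) (lambda c : R) (A : set X) :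
  measurable A -> (forall x, A x -> g x = c) ->
  canonical_measure mu g lambda A =
  ((expR (lambda * c) / partition_function mu g lambda)%:E * mu A)%E.
Proof.
move=> mA gA; rewrite -integral_cst//; apply: eq_integral => x.
by rewrite inE => /gA ->.
Qed.

Lemma simple_partition_val (T : Type) (R : pzRingType) (m : nat)
    (a : 'I_m -> R) (C : 'I_m -> set T) (j : 'I_m) (x : T) :
  trivIset setT C -> C j x -> \sum_(i < m) a i * \1_(C i) x = a j.
Proof.
move=> tC Cjx; rewrite (bigD1 j)//= indicE mem_set// mulr1 big1 ?addr0// => i.
apply: contra_neqP; rewrite indicE; case: (boolP (x \in C i)); last first.
  by rewrite mulr0.
by rewrite inE => Cix _; apply: tC => //; exists x.
Qed.

Theorem mainTheorem6 (d : measure_display) (R : realType)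
    (X : measurableCompleteMetricType d R)
    (X_separable : separable X)
    (X_borel : borel_sigma_algebra X)
    (mu : probability X R)
    (g : {mfun X >-> R})
    (g_bounded : bounded_fun g)
    (g_continuous : continuous_ae mu g)
    (T : set R)
    (T0 : T 0)
    (phi : R -> X -> X)
    (phi_measurable : forall t, T t -> measurable_fun setT (phi t))
    (phi_continuous : forall t, T t -> continuous_ae mu (phi t))
    (phi0 : phi 0 = id)
    (m : nat) (a : 'I_m -> R) (C : 'I_m -> set X)
    (a_distinct : injective a)
    (C_measurable : forall i, measurable (C i))
    (C_partition : partition [set: 'I_m] C [set: X])
    (g_simple : forall x, g x = \sum_(i < m) a i * \1_(C i) x)
    (theta_bij : theta_invertible mu g)
    (T_sym : T = [set - t | t in T])
    (phi_invertible : forall t, T t ->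
      cancel (phi t) (phi (- t)) /\ cancel (phi (- t)) (phi t))
    (phi_preserves : forall t, T t -> forall A : set X, measurable A ->
      pushforward mu (phi t) A = mu A)
    (strong_detailed_balance : forall (i j : 'I_m) t, T t ->
      mu (phi t @^-1` C i `&` C j) = mu (C i `&` phi t @^-1` C j)) :
  forall t, T t -> forall y, y_min g < y < y_max g ->
    psi mu g phi t y = psi mu g phi (- t) y.
Proof.
move=> t Tt y _.
have TNt : T (- t) by rewrite T_sym; exists t.
have mC_phi s i : T s -> measurable (phi s @^-1` C i).
  by move=> Ts; rewrite -[_ @^-1` _]setTI; exact: phi_measurable.
have [_ tC _] := C_partition.
have balance i j :
    mu (phi t @^-1` C i `&` C j) = mu (phi (- t) @^-1` C i `&` C j).
  (* Invariance is read backwards: the right-hand set is replaced by its preimage under [phi t],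
     which turns [phi (- t) @^-1] into the identity on [C i]. *)
  rewrite strong_detailed_balance// -[RHS](phi_preserves _ Tt); last first.
    by apply: measurableI; [exact: mC_phi|].
  congr (mu _); rewrite /= preimage_setI -comp_preimage.
  have -> : phi (- t) \o phi t = id.
    by apply/funext => x /=; rewrite (phi_invertible _ Tt).1.
  by rewrite preimage_id.
rewrite /psi; set lambda := fine _.
(* Boundedness of [g] enters here, through the total mass 1 of [P_lambda]. *)
have finP : (canonical_measure mu g lambda setT < +oo)%E.
  by rewrite canonical_measure_setT// ltry.
(* [g \o phi s] is again simple, with the same values [a i] on the pulled-back cells. *)
have psiE s : T s -> \int[canonical_measure mu g lambda]_x g (phi s x) =
    fine (\sum_(i < m)
      (a i)%:E * canonical_measure mu g lambda (phi s @^-1` C i))%E.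
  move=> Ts; rewrite -Rintegral_simple; last 2 first.
  - exact: finP.
  - by move=> i; exact: mC_phi.
  by apply: eq_Rintegral => x _; rewrite g_simple.
have PE A : measurable A -> canonical_measure mu g lambda A =
    (\sum_(j < m) (expR (lambda * a j) / partition_function mu g lambda)%:E *
      mu (A `&` C j))%E.
  move=> mA; rewrite (measure_ord_partition _ C_partition)//.
  apply: eq_bigr => j _.
  apply: canonical_measure_level_set; first exact: measurableI.
  by move=> x [_ Cjx]; rewrite g_simple (simple_partition_val _ tC Cjx).
rewrite !psiE//; congr fine; apply: eq_bigr => i _; congr (_ * _)%E.
(* The weight of each term depends on [j] and [lambda] but not on the time, so [balance] matches the
   two sums termwise. *)
rewrite !PE; try exact: mC_phi.
by apply: eq_bigr => j _; rewrite balance.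
Qed.
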